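(* Let $\mathbb D,\mathbb E$ be Banach spaces with norms $\|\cdot\|_{\mathbb D},\|\cdot\|_{\mathbb E}$, let $\mathbb D_0\subseteq\mathbb D$, $\mathbb D_\phi\subseteq\mathbb D$, $\theta_0\in\mathbb D_\phi$, and let $\phi:\mathbb D_\phi\to\mathbb E$. Suppose: (1) $\phi$ is Hadamard directionally differentiable at $\theta_0$ tangentially to $\mathbb D_0$, and its derivative $\phi'_{\theta_0}:\mathbb D_0\to\mathbb E$ can be extended to a continuous map on all of $\mathbb D$ (also denoted $\phi'_{\theta_0}$). (2) There are maps $\hat\theta_n:\{X_i\}_{i=1}^n\to\mathbb D_\phi$ and scalars $r_n\uparrow\infty$ with $r_n\{\hat\theta_n-\theta_0\}\stackrel{L}{\rightarrow}\mathbb G_0$ in $\mathbb D$, where $\mathbb G_0$ is tight and its support is included in $\mathbb D_0$. (3) $\hat\theta_n^*:\{X_i,W_i\}_{i=1}^n\to\mathbb D_\phi$ with $\{W_i\}_{i=1}^n$ independent of $\{X_i\}_{i=1}^n$, and $\sup_{f\in \mathrm{BL}_1(\mathbb D)}|E[f(r_n\{\hat\theta_n^*-\hat\theta_n\})|\{X_i\}_{i=1}^n]-E[f(\mathbb G_0)]|=o_p(1)$. (4) The sequence $r_n\{\hat\theta_n^*-\hat\theta_n\}$ is asymptotically measurable (jointly in $\{X_i,W_i\}_{i=1}^n$), and for every continuous bounded $f:\mathbb D\to\mathbf R$, $f(r_n\{\hat\theta_n^*-\hat\theta_n\})$ is a measurable function of $\{W_i\}_{i=1}^n$ outer almost surely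 in $\{X_i\}_{i=1}^n$. (5) $\hat\phi_n':\mathbb D\to\mathbb E$ is a function of $\{X_i\}_{i=1}^n$ such that for every compact $K\subseteq\mathbb D_0$, with $K^\delta\equiv\{a\in\mathbb D:\inf_{b\in K}\|a-b\|_{\mathbb D}<\delta\}$, and every $\epsilon>0$, $$\lim_{\delta\downarrow0}\limsup_{n\to\infty}P\Big(\sup_{h\in K^\delta}\|\hat\phi_n'(h)-\phi'_{\theta_0}(h)\|_{\mathbb E}>\epsilon\Big)=0.$$ Then $$\sup_{f\in \mathrm{BL}_1(\mathbb E)}\big|E[f(\hat\phi_n'(r_n\{\hat\theta_n^*-\hat\theta_n\}))|\{X_i\}_{i=1}^n]-E[f(\phi'_{\theta_0}(\mathbb G_0))]\big|=o_p(1).$$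
   Context: Banach spaces are over the reals. A map $\phi:\mathbb D_\phi\subseteq\mathbb D\to\mathbb E$ is Hadamard directionally differentiable at $\theta\in\mathbb D_\phi$ tangentially to $\mathbb D_0\subseteq\mathbb D$ if there is a continuous (not necessarily linear) map $\phi'_\theta:\mathbb D_0\to\mathbb E$ such that $\lim_{n}\|\{\phi(\theta+t_nh_n)-\phi(\theta)\}/t_n-\phi'_\theta(h)\|_{\mathbb E}=0$ for all $\{h_n\}\subset\mathbb D$, $\{t_n\}\subset\mathbf R_+$ with $t_n\downarrow0$, $h_n\to h\in\mathbb D_0$ and $\theta+t_nh_n\in\mathbb D_\phi$ for all $n$. $\{X_i\}_{i=1}^n$ is the data and $\{W_i\}_{i=1}^n$ are random weights; $\hat\theta_n:\{X_i\}_{i=1}^n\to\mathbb D_\phi$ means $\hat\theta_n$ is a (not necessarily measurable) $\mathbb D_\phi$-valued function of the data, and similarly for $\hat\theta_n^*$. ''$\hat\phi_n'$ is a function of $\{X_i\}_{i=1}^n$'' means that $\hat\phi_n'$ is a data-dependent map $\mathbb D\to\mathbb E$ (not depending on the weights). Convergence in distribution $\stackrel{L}{\to}$ is in the Hoffman-Jørgensen sense: $Z_n\stackrel{L}{\to}Z$ ($Z$ Borel) means $E^*[f(Z_n)]\to E[f(Z)]$ for all bounded continuous real $f$, where $E^*$ is outer expectation ($E_*$ inner expectation). Expectations and probabilities of possibly nonmeasurable objects are outer ones; $o_p(1)$ is convergence to zero in outer probability. $E[\,\cdot\,|\{X_i\}_{i=1}^n]$ denotes outer expectation with respect to the joint law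 of $\{W_i\}_{i=1}^n$ treating the data as constant. $Z_n$ is asymptotically measurable if $E^*[f(Z_n)]-E_*[f(Z_n)]\to0$ for all bounded continuous $f$. For a normed space $\mathbf A$, $\mathrm{BL}_1(\mathbf A)=\{f:\mathbf A\to\mathbf R:\ |f(a)|\le1,\ |f(a)-f(a')|\le\|a-a'\|_{\mathbf A}\ \forall a,a'\in\mathbf A\}$. $\mathbb G_0$ is a Borel random element of $\mathbb D$. *)

(* Defs.v *)
From HB Require Import structures.
From mathcomp Require Import all_boot all_order all_algebra.
From mathcomp Require Import all_classical all_reals all_analysis.
From mathcomp Require Import measurable_realfun.

Set Implicit Arguments.
Unset Strict Implicit.
Unset Printing Implicit Defensive.

Import Order.TTheory GRing.Theory Num.Theory.
Import numFieldTopology.Exports numFieldNormedType.Exports.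

Local Open Scope classical_set_scope.
Local Open Scope ring_scope.

Section hadamard.
Context {R : realType} {D E : normedModType R}.

(* A map on a subset of D is represented by a total function; its values
   outside the subset never matter. *)
Definition hadamard_dir_derivative (Dphi : set D) (phi : D -> E) (theta : D)
    (D0 : set D) (dphi : D -> E) : Prop :=
  {within D0, continuous dphi} /\
  forall (h : nat -> D) (h0 : D) (t : nat -> R),
    (forall n, 0 < t n) -> nonincreasing_seq t -> t @ \oo --> (0 : R) ->
    D0 h0 -> h @ \oo --> h0 ->
    (forall n, Dphi (theta + t n *: h n)) ->
    (fun n => `| (t n)^-1 *: (phi (theta + t n *: h n) - phi theta)
                 - dphi h0 |) @ \oo --> (0 : R).

End hadamard.

Section topology.
Context {R : realType} {A : normedModType R}.

Definition bounded_continuous (f : A -> R) : Prop :=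
  continuous f /\ exists M : R, forall a, `|f a| <= M.

Definition BL1 : set (A -> R) :=
  [set f | (forall a, `|f a| <= 1) /\
           (forall a a', `|f a - f a'| <= `|a - a'|)].

(* The infimum is taken in the extended reals, so that the enlargement of the
   empty set is empty. *)
Definition enlargement (K : set A) (delta : R) : set A :=
  [set a | (ereal_inf [set (`|a - b|)%:E | b in K] < delta%:E)%E].

End topology.

Notation borelType T := (g_sigma_algebraType (@open T)).

Section outer.
Context {d : measure_display} {T : measurableType d} {R : realType}.
Variable mu : {measure set T -> \bar R}.
Local Open Scope ereal_scope.

(* The second condition says that the integral of U exists; without it the
   convention +oo - +oo = -oo would make the infimum meaningless. *)
Definition measurable_majorant (f : T -> R) (U : T -> \bar R) : Prop :=
  [/\ measurable_fun [set: T] U,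
      \int[mu]_w (U ^\+ w) < +oo \/ \int[mu]_w (U ^\- w) < +oo &
      forall w, (f w)%:E <= U w].

Definition outer_expectation (f : T -> R) : \bar R :=
  ereal_inf [set \int[mu]_w U w | U in measurable_majorant f].

Definition inner_expectation (f : T -> R) : \bar R :=
  - outer_expectation (fun w => (- f w)%R).

Definition outer_prob (A : set T) : \bar R :=
  ereal_inf [set mu B | B in [set B | measurable B /\ A `<=` B]].

End outer.

Section random_elements.
Context {R : realType}.
Local Open Scope ereal_scope.

Section laws.
Context {d : measure_display} {T : measurableType d}.
Variable P : probability T R.

Definition independent_rvs {d1 d2 : measure_display} {T1 : measurableType d1}
    {T2 : measurableType d2} (X : {RV P >-> T1}) (Y : {RV P >-> T2}) : Prop :=
  forall (A : set T1) (B : set T2), measurable A -> measurable B ->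
    P ((X @^-1` A) `&` (Y @^-1` B)) = P (X @^-1` A) * P (Y @^-1` B).

Definition tight_element {A : normedModType R}
    (G : {RV P >-> borelType A}) : Prop :=
  forall eps : R, (0 < eps)%R ->
    exists2 K : set A, compact K & P (G @^-1` (~` K)) <= eps%:E.

Definition law_support {A : normedModType R}
    (G : {RV P >-> borelType A}) : set A :=
  [set a | forall U : set A, open U -> U a -> 0 < P (G @^-1` U)].

End laws.

Section pairing.
Context {d d1 d2 : measure_display} {T : measurableType d}
  {T1 : measurableType d1} {T2 : measurableType d2}.

Definition pair_fun (X : T -> T1) (Y : T -> T2) (w : T) : T1 * T2 :=
  (X w, Y w).

Variables (X : {mfun T >-> T1}) (Y : {mfun T >-> T2}).

Let measurable_pair_fun : measurable_fun [set: T] (pair_fun X Y).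
Proof. by apply/measurable_fun_pairP; split; exact: measurable_funPT. Qed.

HB.instance Definition _ :=
  isMeasurableFun.Build _ _ _ _ (pair_fun X Y) measurable_pair_fun.

End pairing.

Section asymptotics.
Context {d : measure_display} {T : nat -> measurableType d}.
Variable P : forall n, probability (T n) R.

Definition weak_cvg {dG : measure_display} {TG : measurableType dG}
    {A : normedModType R} (Z : forall n, T n -> A)
    (PG : probability TG R) (G : {RV PG >-> borelType A}) : Prop :=
  forall f : A -> R, bounded_continuous f ->
    (fun n => outer_expectation (P n) (f \o Z n)) @ \oo --> 'E_PG[f \o G].

Definition asymptotically_measurable {A : normedModType R}
    (Z : forall n, T n -> A) : Prop :=
  forall f : A -> R, bounded_continuous f ->
    (fun n => outer_expectation (P n) (f \o Z n)
              - inner_expectation (P n) (f \o Z n)) @ \oo --> 0.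

Definition little_op (V : forall n, T n -> \bar R) : Prop :=
  forall eps : R, (0 < eps)%R ->
    (fun n => outer_prob (P n) [set x | eps%:E < `|V n x|]) @ \oo --> 0.

End asymptotics.

Definition bl_dist {d dG : measure_display} {T : measurableType d}
    {TG : measurableType dG} {A : normedModType R}
    (P : probability T R) (Z : T -> A)
    (PG : probability TG R) (G : TG -> A) : \bar R :=
  ereal_sup [set `| outer_expectation P (f \o Z) - 'E_PG[f \o G] |
            | f in @BL1 R A].

End random_elements.

(* Main.v *)
(** Fix the data. Choose a compact [K] in the support of [G0], every open
    enlargement of which carries almost all the mass of [G0], and a radius [s]
    such that [phihat] is close to [dphi] on [enlargement K s]. For [f] in
    [BL1 E], the function [u = f \o dphi] is not Lipschitz, but on a small
    enlargement of [K] it is uniformly close to the Lipschitz function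
    [min 1 (inf_(b in K) (u b + L |a - b|))]; applied to [u = 0] with a larger
    constant, the same formula gives a Lipschitz majorant of the indicator of
    the complement of [enlargement K s]. Both constants are independent of [f],
    so the bounded Lipschitz distance of [G0] to the bootstrap law controls, by
    monotonicity and subadditivity of the outer expectation, the distance after
    applying [phihat]. *)

Require Import Defs.
From HB Require Import structures.
From mathcomp Require Import all_boot all_order all_algebra finmap.
From mathcomp Require Import all_classical all_reals all_analysis.
From mathcomp Require Import measurable_realfun.
From mathcomp Require Import lra.

Import Order.TTheory GRing.Theory Num.Theory.
Import numFieldTopology.Exports numFieldNormedType.Exports.

Local Open Scope classical_set_scope.
Local Open Scope ring_scope.

(** * Truncated Lipschitz envelopes of bounded functions *)

Section lipschitz_minorant.
Context {R : realType} {A : normedModType R}.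

(** The McShane (Pasch-Hausdorff) envelope of [u] restricted to [K], cut off at 1. It is a minorant
    of [u] on [K] only. When [u >= -1] and [L >= 0], the lower bound is inherited, so only the upper
    side is truncated. *)
Definition lip_minorant (K : set A) (L : R) (u : A -> R) (a : A) : R :=
  Num.min 1 (inf [set u b + L * `|a - b| | b in K]).

Context (K : set A) (L : R) (u : A -> R).
Hypotheses (K0 : K !=set0) (L0 : 0 <= L) (u1 : forall a, `|u a| <= 1).

Lemma lip_minorant_le a b : K b -> lip_minorant K L u a <= u b + L * `|a - b|.
Proof.
move=> Kb; rewrite /lip_minorant ge_min; apply/orP; right.
apply: ge_inf; last by exists b.
(* The real infimum needs a lower bound: [-1] works since [u >= -1] and [L >= 0]. *)
exists (- 1) => _ [c _ <-].
have := u1 c; rewrite ler_norml => /andP[? _].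
have : 0 <= L * `|a - c| by rewrite mulr_ge0.
lra.
Qed.

Lemma le_lip_minorant a c : c <= 1 ->
  (forall b, K b -> c <= u b + L * `|a - b|) -> c <= lip_minorant K L u a.
Proof.
move=> c1 cK; rewrite /lip_minorant le_min c1 /=; apply: lb_le_inf.
  (* The real [inf] of an empty set is 0 by default, so a point of [K] is required. *)
  by case: K0 => b Kb; exists (u b + L * `|a - b|); exists b.
by move=> _ [b Kb <-]; exact: cK.
Qed.

Lemma lip_minorant_bound a : `|lip_minorant K L u a| <= 1.
Proof.
rewrite ler_norml; apply/andP; split; last by rewrite /lip_minorant ge_min lexx.
apply: le_lip_minorant => [|b _]; first lra.
have := u1 b; rewrite ler_norml => /andP[? _].
have : 0 <= L * `|a - b| by rewrite mulr_ge0.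
lra.
Qed.

(** Each function under the infimum is [L]-Lipschitz, which infimum and truncation preserve; by
    symmetry a one-sided estimate suffices. *)
Lemma lip_minorant_lip a a' :
  `|lip_minorant K L u a - lip_minorant K L u a'| <= L * `|a - a'|.
Proof.
have half x y : lip_minorant K L u x <= lip_minorant K L u y + L * `|x - y|.
  rewrite -lerBlDr; apply: le_lip_minorant => [|b Kb].
    have := lip_minorant_bound x; rewrite ler_norml => /andP[_ ?].
    have : 0 <= L * `|x - y| by rewrite mulr_ge0.
    lra.
  rewrite lerBlDr; apply: (le_trans (lip_minorant_le x b Kb)).
  rewrite -addrA lerD2l -mulrDr ler_wpM2l //.
  by have := ler_normD (x - y) (y - b); rewrite addrA subrK; lra.
have := half a a'; have := half a' a; rewrite (distrC a' a) ler_norml.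
by move=> ? ?; apply/andP; split; lra.
Qed.

End lipschitz_minorant.

(** * Enlargements, rescaling into [BL1], and approximation near [K] *)

Section bounded_lipschitz.
Context {R : realType} {A : normedModType R}.

Lemma enlargementP (K : set A) (s : R) a :
  enlargement K s a <-> exists2 b, K b & `|a - b| < s.
Proof.
split=> [/ereal_inf_lt[_ [b Kb <-]] | [b Kb abs]]; first by exists b.
rewrite /enlargement/=; apply: (@le_lt_trans _ _ (`|a - b|)%:E) => //.
by apply: ereal_inf_lbound; exists b.
Qed.

Lemma open_enlargement (K : set A) (s : R) : open (enlargement K s).
Proof.
rewrite openE => a /enlargementP[b Kb abs].
apply/nbhs_ballP; exists (s - `|a - b|) => /=; first by rewrite subr_gt0.
move=> c; rewrite -ball_normE /= => acs; apply/enlargementP; exists b => //.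
have := ler_normD (c - a) (a - b); rewrite addrA subrK (distrC c a); lra.
Qed.

(** Lets one bounded Lipschitz distance control every [L]-Lipschitz function, at the cost of a
    factor [L]; [1 <= L] preserves the bound 1. *)
Lemma BL1_scale (g : A -> R) (L : R) : 1 <= L -> (forall a, `|g a| <= 1) ->
  (forall a a', `|g a - g a'| <= L * `|a - a'|) -> BL1 (fun a => L^-1 * g a).
Proof.
move=> L1 g1 glip; have L0 : 0 < L by lra.
have Li0 : 0 <= L^-1 by rewrite invr_ge0 ltW.
split=> [a|a a'].
  by rewrite normrM (ger0_norm Li0) ler_pdivrMl // mulr1 (le_trans (g1 a)).
by rewrite -mulrBr normrM (ger0_norm Li0) ler_pdivrMl.
Qed.

Lemma lipschitz_continuous (g : A -> R) (L : R) : 1 <= L ->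
  (forall a a', `|g a - g a'| <= L * `|a - a'|) -> continuous g.
Proof.
move=> L1 glip a; have L0 : 0 < L by lra.
apply/cvgrPdist_lt => e e0; near=> b; apply: (le_lt_trans (glip a b)).
rewrite -ltr_pdivlMl //; near: b; apply: cvgr_dist_lt => //.
by rewrite mulr_gt0 // invr_gt0.
Unshelve. all: by end_near. Qed.

Context (K : set A) (K0 : K !=set0).

(** For the upper bound on the envelope, use a point of [K] within [s]: it costs [e] from [u] and
    [L * s <= e] from the slope. For the lower bound, points of [K] within [dl] have nearly the same
    value of [u], and those farther away contribute at least [-1 + L * dl >= 1]. *)
Lemma lip_minorant_approx (L e s dl : R) (u : A -> R) a :
  0 <= L -> (forall a, `|u a| <= 1) ->
  (forall b a, K b -> `|a - b| < dl -> `|u a - u b| <= e) ->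
  2 <= L * dl -> s <= dl -> L * s <= e ->
  enlargement K s a -> `|u a - lip_minorant K L u a| <= e + e.
Proof.
move=> L0 u1 udl Ldl sdl Ls /enlargementP[b Kb abs].
have := u1 a; rewrite ler_norml => /andP[ua1 ua2].
have := udl b a Kb (lt_le_trans abs sdl); rewrite ler_norml => /andP[uab1 uab2].
have Lab : L * `|a - b| <= L * s by rewrite ler_wpM2l // ltW.
have Tle := lip_minorant_le K L u L0 u1 a b Kb.
have leT : u a - e <= lip_minorant K L u a.
  apply: le_lip_minorant => //; first lra.
  move=> c Kc; have [acd|dac] := ltP `|a - c| dl.
    have := udl c a Kc acd; rewrite ler_norml => /andP[_ ?].
    have : 0 <= L * `|a - c| by rewrite mulr_ge0.
    lra.
  have : L * dl <= L * `|a - c| by rewrite ler_wpM2l.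
  by have := u1 c; rewrite ler_norml => /andP[? _]; lra.
by rewrite ler_norml; apply/andP; split; lra.
Qed.

(** For [u = 0] the envelope is [min 1 (L * d(a, K))], a Lipschitz substitute for the indicator of
    being far from [K]. *)
Lemma lip_minorant0_ge0 (L : R) a : 0 <= L -> 0 <= lip_minorant K L (fun=> 0) a.
Proof.
move=> L0; apply: le_lip_minorant => // b _.
by rewrite add0r mulr_ge0.
Qed.

Lemma lip_minorant0_far (L s : R) a : 0 <= L -> 1 <= L * s ->
  ~ enlargement K s a -> 1 <= lip_minorant K L (fun=> 0) a.
Proof.
move=> L0 Ls nKa; apply: le_lip_minorant => // b Kb.
rewrite add0r (le_trans Ls) // ler_wpM2l // leNgt; apply/negP => abs.
by apply: nKa; apply/enlargementP; exists b.
Qed.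

(** Meant for a smaller radius than in [lip_minorant0_far]: the mass of the limit law outside that
    smaller enlargement then bounds, up to [e], the mean of the envelope. *)
Lemma lip_minorant0_near (L s e : R) a : 0 <= L -> L * s <= e ->
  enlargement K s a -> lip_minorant K L (fun=> 0) a <= e.
Proof.
move=> L0 Ls /enlargementP[b Kb abs].
apply: (le_trans (lip_minorant_le K L (fun=> 0) L0 _ a b Kb)).
  by move=> ?; rewrite normr0.
by rewrite add0r (le_trans _ Ls) // ler_wpM2l // ltW.
Qed.

End bounded_lipschitz.

(** * Continuity that is uniform around a compact set *)

Section compact_continuity.
Context {R : realType} {A : normedModType R}.

(* Unlike the Heine-Cantor theorem, only the center is in the compact set. *)
Lemma compact_uniform_nbhs {B : normedModType R} (f : A -> B) (K : set A)
    (e : R) : compact K -> continuous f -> 0 < e ->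
  exists2 s : R, 0 < s &
    forall b a, K b -> `|a - b| < s -> `|f a - f b| <= e.
Proof.
move=> cK cf e0.
pose Q (s : R) b := forall a, `|a - b| < s -> `|f a - f b| <= e.
have QK : \forall s \near 0^'+, K `<=` Q s.
  (* Near-covering compactness leaves only a local statement, near each [x] of [K] and for small
     [s]. *)
  apply: (iffLR (compact_near_coveringP K) cK) => x Kx.
  have e20 : 0 < e / 2 by lra.
  have /cvgrPdist_lt/(_ _ e20)/nbhs_ballP[p /= p0 pf] := cf x.
  have p20 : 0 < p / 2 by lra.
  (* Half of [p] for the center and half for the radius keep both [b] and [a] within [p] of [x]. *)
  exists (ball x (p / 2), [set s | s < p / 2]).
    by split; [exact: nbhsx_ballx | exact: nbhs_right_lt].
  move=> [b s] [/= xb sp] a abs.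
  have fb : `|f x - f b| < e / 2.
    by apply: pf; apply: le_ball xb; lra.
  have fa : `|f x - f a| < e / 2.
    apply: pf; move: xb; rewrite -!ball_normE /= => xb.
    have := ler_normD (x - b) (b - a); rewrite addrA subrK (distrC b a).
    by move=> ?; lra.
  have := ler_normD (f a - f x) (f x - f b).
  by rewrite addrA subrK (distrC (f a) (f x)); lra.
have [s [s0 sQ]] : exists s : R, 0 < s /\ K `<=` Q s.
  near (0 : R)^'+ => s; exists s.
  by split; near: s; [exact: nbhs_right_gt | exact: QK].
by exists s => // b a Kb; exact: sQ.
Unshelve. all: by end_near. Qed.

End compact_continuity.

(** * Outer expectations of bounded functions *)

Section outer_expectation_theory.
Context {d : measure_display} {T : measurableType d} {R : realType}.
Variable Q : probability T R.
Local Open Scope ereal_scope.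

(** The majorant is at least [-M], so its negative part has finite integral; a total below [+oo]
    then forces the same for the positive part. *)
Lemma majorant_integrable (f : T -> R) (U : T -> \bar R) (M : R) :
  (forall w, `|f w| <= M)%R -> measurable_majorant Q f U ->
  \int[Q]_w U w < +oo -> Q.-integrable [set: T] U.
Proof.
move=> fM [mU _ fU] Ufin.
have Uneg : \int[Q]_w U^\- w <= M%:E.
  rewrite -[M%:E]mule1 -(probability_setT Q) -integral_cst //.
  apply: ge0_le_integral => //; first exact: measurable_funeneg.
  move=> w _; have := fM w; rewrite ler_norml => /andP[fM1 _].
  have M0 : (0 <= M)%R by apply: le_trans (fM w).
  rewrite funenegE ge_max lee_fin M0 andbT leeNl.
  by apply: le_trans (fU w); rewrite lee_fin.
have Unegfin : \int[Q]_w U^\- w \is a fin_num.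
  by rewrite ge0_fin_numE ?integral_ge0 // (le_lt_trans Uneg) ?ltry.
apply/integrableP; split => //.
under eq_integral do rewrite -[ `|U _| ]/((abse \o U) _) fune_abse.
rewrite ge0_integralD //; [|exact: measurable_funepos|exact: measurable_funeneg].
rewrite integralE in Ufin; move: Ufin Unegfin.
case: (\int[Q]_w U^\+ w) (\int[Q]_w U^\- w) => [x| |] [y| |] //=.
by move=> _ _; rewrite ltry.
Qed.

Lemma outer_expectation_le_integral (f : T -> R) (U : T -> \bar R) :
  Q.-integrable [set: T] U -> (forall w, (f w)%:E <= U w) ->
  outer_expectation Q f <= \int[Q]_w U w.
Proof.
move=> iU fU; apply: ereal_inf_lbound; exists U => //; split => //.
  exact: measurable_int iU.
by left; apply: integrable_lty => //; exact: integrable_funepos.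
Qed.

Lemma outer_expectation_fin_num (f : T -> R) (M : R) :
  (forall w, `|f w| <= M)%R -> outer_expectation Q f \is a fin_num.
Proof.
move=> fM; have ic (c : R) : Q.-integrable [set: T] (fun=> c%:E).
  exact: (finite_measure_integrable_cst Q).
have cE (c : R) : \int[Q]_w c%:E = c%:E.
  by rewrite integral_cst //= probability_setT mule1.
rewrite fin_numElt; apply/andP; split; last first.
  rewrite (le_lt_trans (outer_expectation_le_integral f (fun=> M%:E) (ic M) _)) //.
    by move=> w; rewrite lee_fin; have := fM w; rewrite ler_norml => /andP[].
  by rewrite cE ltry.
apply: (@lt_le_trans _ _ (- M)%:E); first by rewrite ltNyr.
apply: le_ereal_inf_tmp => _ [U majU <-].
have [->|Ufin] := eqVneq (\int[Q]_w U w) +oo; first by rewrite leey.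
rewrite -(cE (- M)%R); apply: le_integral => //.
  by apply: majorant_integrable _ _ _ fM majU _; rewrite ltey.
move=> w _; case: majU => _ _ fU; apply: le_trans (fU w).
by rewrite lee_fin; have := fM w; rewrite ler_norml => /andP[].
Qed.

(** A bounded measurable function is its own least majorant. *)
Lemma outer_expectation_measurable (f : T -> R) (M : R) :
  (forall w, `|f w| <= M)%R -> measurable_fun [set: T] f ->
  outer_expectation Q f = 'E_Q[f].
Proof.
move=> fM mf; rewrite unlock.
have intf : Q.-integrable [set: T] (EFin \o f).
  apply: measurable_bounded_integrable => //.
    by rewrite ltey_eq fin_num_measure.
  exists M; split=> [|N /ltW MN w _]; first exact: num_real.
  exact: le_trans (fM w) MN.
apply/le_anti/andP; split; first exact: outer_expectation_le_integral.
apply: le_ereal_inf_tmp => _ [U majU <-].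
have [->|Ufin] := eqVneq (\int[Q]_w U w) +oo; first by rewrite leey.
apply: le_integral => //; last by case: majU => _ _ fU w _; exact: fU.
by apply: majorant_integrable _ _ _ fM majU _; rewrite ltey.
Qed.

(** Monotonicity, positive homogeneity and subadditivity in one inequality: near-optimal majorants
    [U] of [g] and [V] of [h] combine into the majorant [c + a * U + b * V] of [f]. Nonnegative
    coefficients preserve the direction of the bounds. *)
Lemma outer_expectation_le (f g h : T -> R) (M a b c : R) :
  (forall w, `|g w| <= M)%R -> (forall w, `|h w| <= M)%R ->
  (0 <= a)%R -> (0 <= b)%R ->
  (forall w, f w <= c + a * g w + b * h w)%R ->
  outer_expectation Q f <=
    c%:E + a%:E * outer_expectation Q g + b%:E * outer_expectation Q h.
Proof.
move=> gM hM a0 b0 fgh; apply/lee_addgt0Pr => e e0.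
have s0 : (0 < a + b + 1)%R by lra.
(* The total excess is [(a + b) * e' <= e]; the added 1 covers [a = b = 0]. *)
pose e' := (e / (a + b + 1))%R; have e'0 : (0 < e')%R by rewrite divr_gt0.
have egf := outer_expectation_fin_num _ _ gM.
have ehf := outer_expectation_fin_num _ _ hM.
have [_ [U majU <-] Ug] := lb_ereal_inf_adherent e'0 egf.
have [_ [V majV <-] Vh] := lb_ereal_inf_adherent e'0 ehf.
have iU : Q.-integrable [set: T] U.
  apply: majorant_integrable _ _ _ gM majU _; apply: lt_trans Ug _.
  by rewrite -/(outer_expectation Q g) -(fineK egf) -EFinD ltry.
have iV : Q.-integrable [set: T] V.
  apply: majorant_integrable _ _ _ hM majV _; apply: lt_trans Vh _.
  by rewrite -/(outer_expectation Q h) -(fineK ehf) -EFinD ltry.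
have ic : Q.-integrable [set: T] (fun=> c%:E).
  exact: (finite_measure_integrable_cst Q).
have iaU := integrableZl measurableT a iU.
have ibV := integrableZl measurableT b iV.
have icU := integrableD measurableT ic iaU.
apply: le_trans (outer_expectation_le_integral f
  (((fun=> c%:E) \+ (fun w => a%:E * U w)) \+ (fun w => b%:E * V w)) _ _) _.
- exact: integrableD.
- move=> w; rewrite /=; case: majU => _ _ /(_ w) gU; case: majV => _ _ /(_ w) hV.
  apply: (@le_trans _ _ (c%:E + a%:E * (g w)%:E + b%:E * (h w)%:E)).
    by rewrite -!EFinM -!EFinD lee_fin.
  by rewrite !leeD // lee_wpmul2l // lee_fin.
rewrite integralD // integralD // !integralZl // integral_cst //=.
rewrite probability_setT mule1; move: Ug Vh.
rewrite -/(outer_expectation Q g) -/(outer_expectation Q h).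
rewrite -(fineK egf) -(fineK ehf) -(fineK (integrable_fin_num measurableT iU)).
rewrite -(fineK (integrable_fin_num measurableT iV)).
rewrite -!EFinM -!EFinD !lte_fin lee_fin => Ug Vh.
move: Ug Vh; set x := fine _; set y := fine _; set z := fine _; set t := fine _.
move=> xy zt.
have : (a * x <= a * (y + e'))%R by rewrite ler_wpM2l // ltW.
have : (b * z <= b * (t + e'))%R by rewrite ler_wpM2l // ltW.
have : ((a + b) * e' <= e)%R.
  by rewrite /e' mulrA ler_pdivrMr // mulrC ler_pM2l //; lra.
by rewrite !(mulrDr, mulrDl) => *; lra.
Qed.

Lemma outer_expectation_fine_le (f g h : T -> R) (M a b c : R) :
  (forall w, `|f w| <= M)%R -> (forall w, `|g w| <= M)%R ->
  (forall w, `|h w| <= M)%R -> (0 <= a)%R -> (0 <= b)%R ->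
  (forall w, f w <= c + a * g w + b * h w)%R ->
  (fine (outer_expectation Q f) <=
    c + a * fine (outer_expectation Q g) + b * fine (outer_expectation Q h))%R.
Proof.
move=> fM gM hM a0 b0 fgh.
rewrite -lee_fin !EFinD !EFinM (fineK (outer_expectation_fin_num _ _ fM)).
rewrite (fineK (outer_expectation_fin_num _ _ gM)).
rewrite (fineK (outer_expectation_fin_num _ _ hM)).
exact: outer_expectation_le gM hM a0 b0 fgh.
Qed.

Lemma outer_expectation_fineZ (f : T -> R) (M a : R) :
  (forall w, `|f w| <= M)%R -> (0 < a)%R ->
  (fine (outer_expectation Q (fun w => a * f w)) =
    a * fine (outer_expectation Q f))%R.
Proof.
(* The absolute values make [N] a common bound for [f], [a * f] and 0 whatever the sign of [M]. The
   equality then follows from scaling by [a] and by [a^-1]. *)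
move=> fM a0; pose N := (`|M| + `|a * M|)%R.
have fN w : (`|f w| <= N)%R.
  by rewrite (le_trans (fM w)) // (le_trans (ler_norm _)) // lerDl.
have afN w : (`|a * f w| <= N)%R.
  rewrite normrM (ger0_norm (ltW a0)) (@le_trans _ _ (a * M)%R) //.
    by rewrite ler_pM2l.
  by rewrite (le_trans (ler_norm _)) // lerDr.
have zN (w : T) : (`|0 : R| <= N)%R by rewrite normr0 addr_ge0.
apply/eqP; rewrite eq_le; apply/andP; split.
  have := @outer_expectation_fine_le _ f (fun=> 0%R) N a 0%R 0%R afN fN zN.
  rewrite !mul0r addr0 add0r; apply => // [|w]; first exact: ltW.
  by rewrite ?mul0r addr0 add0r.
rewrite -ler_pdivlMl //.
have := @outer_expectation_fine_le _ _ (fun=> 0%R) N a^-1 0%R 0%R fN afN zN.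
rewrite !mul0r addr0 add0r; apply => // [|w]; first by rewrite invr_ge0 ltW.
by rewrite ?mul0r addr0 add0r mulKf // gt_eqF.
Qed.

End outer_expectation_theory.

(** * Outer probabilities *)

Section outer_prob_theory.
Context {d : measure_display} {T : measurableType d} {R : realType}.
Variable Q : probability T R.
Local Open Scope ereal_scope.

Lemma outer_prob_ge0 (A : set T) : 0 <= outer_prob Q A.
Proof. by apply: le_ereal_inf_tmp => _ [B _ <-]. Qed.

Lemma outer_prob_fin_num (A : set T) : outer_prob Q A \is a fin_num.
Proof.
rewrite ge0_fin_numE ?outer_prob_ge0 //; apply: (@le_lt_trans _ _ (Q [set: T])).
  by apply: ereal_inf_lbound; exists [set: T].
by rewrite probability_setT ltry.
Qed.

Lemma outer_probU_le (A B C : set T) : A `<=` B `|` C ->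
  outer_prob Q A <= outer_prob Q B + outer_prob Q C.
Proof.
move=> ABC; apply/lee_addgt0Pr => e e0; have e20 : (0 < e / 2)%R by rewrite divr_gt0.
have [_ [U [mU BU] <-] Ub] := lb_ereal_inf_adherent e20 (outer_prob_fin_num B).
have [_ [V [mV CV] <-] Vc] := lb_ereal_inf_adherent e20 (outer_prob_fin_num C).
apply: (@le_trans _ _ (Q (U `|` V))).
  apply: ereal_inf_lbound; exists (U `|` V) => //; split; first exact: measurableU.
  by apply: (subset_trans ABC); exact: setUSS.
apply: (le_trans (measureU2 _ mU mV)); apply: (le_trans (leeD (ltW Ub) (ltW Vc))).
by rewrite addeACA -EFinD -splitr.
Qed.

End outer_prob_theory.

(** * Limits to 0 and upper limits in the extended reals *)

Section nonneg_ereal_limits.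
Context {R : realType}.
Local Open Scope ereal_scope.

Lemma cvge0_lt {I : Type} {F : set_system I} {FF : Filter F} (u : I -> \bar R)
    (e : R) : u @ F --> 0 -> (0 < e)%R -> \forall i \near F, u i < e%:E.
Proof.
move=> u0 e0.
have := u0 [set x | x < e%:E]; apply.
by apply: open_nbhs_nbhs; split; [exact: open_ereal_lt_ereal | rewrite /= lte_fin].
Qed.

Lemma cvge0P {I : Type} {F : set_system I} {FF : Filter F} (u : I -> \bar R) :
  (forall i, 0 <= u i) ->
  (forall e : R, (0 < e)%R -> \forall i \near F, u i < e%:E) -> u @ F --> 0.
Proof.
move=> u0 ue; apply/fine_cvgP; split.
  near=> i; rewrite ge0_fin_numE // (@lt_trans _ _ 1%:E) ?ltry //.
  by near: i; exact: ue.
apply/cvgrPdist_lt => e e0; near=> i.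
have : u i < e%:E by near: i; exact: ue.
rewrite sub0r normrN /=; have := u0 i.
by case: (u i) => //= x; rewrite !lee_fin lte_fin => x0; rewrite ger0_norm.
Unshelve. all: by end_near. Qed.

(** The upper limit is an infimum of suprema over tails, so a strict bound holds on some tail. *)
Lemma limn_esup_lt (u : nat -> \bar R) (c : \bar R) :
  limn_esup u < c -> \forall n \near \oo, u n < c.
Proof.
move=> /ereal_inf_lt[_ [V FV <-]] Vc; apply: filterS FV => n Vn.
by apply: le_lt_trans Vc; apply: ereal_sup_ubound; exists n.
Qed.

End nonneg_ereal_limits.

(** * Borel random elements, supports and tightness *)

Section borel_elements.
Context {R : realType} {A : normedModType R} {d : measure_display}
  {T : measurableType d} {Q : probability T R}.
Variable G : {RV Q >-> borelType A}.

Lemma measurable_preimage_open (U : set A) : open U -> measurable (G @^-1` U).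
Proof.
by move=> oU; apply: measurable_funPTI; exact: sub_sigma_algebra.
Qed.

Lemma measurable_preimage_closed (U : set A) : closed U -> measurable (G @^-1` U).
Proof.
move=> /closed_openC/measurable_preimage_open/measurableC.
by rewrite preimage_setC setCK.
Qed.

Lemma measurable_continuous_comp (f : A -> R) :
  continuous f -> measurable_fun [set: T] (f \o G).
Proof.
move=> cf; apply: (measurability _ (RGenOpens.measurableE R)) => _ [_ [a [b ->] <-]].
rewrite setTI comp_preimage; apply: measurable_preimage_open.
by apply: open_comp; [move=> x _; exact: cf|exact: interval_open].
Qed.

Lemma closed_law_support : closed (law_support G).
Proof.
move=> a cla U oU Ua.
have [b [Gb Ub]] := cla U (open_nbhs_nbhs (conj oU Ua)).
exact: Gb.
Qed.

(* The part of a compact set off the support is only approximated from inside: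
   its intersection with the complement of an open enlargement is compact,
   hence covered by finitely many null open sets. *)
Lemma tight_support (eps : R) : tight_element G -> 0 < eps ->
  exists K : set A, [/\ compact K, K `<=` law_support G &
    forall s, 0 < s -> (Q (G @^-1` (~` enlargement K s)) <= eps%:E)%E].
Proof.
move=> tG eps0; have [K cK QK] := tG _ eps0.
have clK : closed K by apply: compact_closed cK; exact: norm_hausdorff.
exists (K `&` law_support G); split.
- apply: (subclosed_compact _ cK); last exact: subIsetl.
  by apply: closedI => //; exact: closed_law_support.
- exact: subIsetr.
move=> s s0; set E := enlargement _ s.
have oE : open E by exact: open_enlargement.
have cKE : compact (K `\` E).
  apply: (subclosed_compact _ cK); last exact: subDsetl.
  by apply: closedI => //; exact: open_closedC.
have null : Q (G @^-1` (K `\` E)) = 0%E.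
  (* Every point of [K] outside [E] is off the support, hence has a neighborhood in this family of
     null open sets; the family is closed under finite unions. *)
  pose D := [set U : set A | open U /\ Q (G @^-1` U) = 0%E].
  have := cKE; rewrite compact_cover => /(_ _ D id)[U []//||F FD KF].
    move=> a [Ka nEa]; have : ~ law_support G a.
      move=> Sa; apply: nEa; apply/enlargementP; exists a => //.
      by rewrite subrr normr0.
    rewrite /law_support /= => /existsNP[U /not_implyP[oU /not_implyP[Ua /negP]]].
    rewrite -leNgt measure_le0 => /eqP QU.
    by exists U.
  have [] : D (\big[setU/set0]_(i <- F) i).
    rewrite big_seq; apply: big_ind => [|U V [oU QU] [oV QV]|U /FD /set_mem //].
      by split; [exact: open0|rewrite preimage_set0 measure0].
    split; first exact: openU.
    by rewrite preimage_setU measureU0 //; exact: measurable_preimage_open.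
  move=> oF QF; apply/eqP; rewrite -measure_le0 -QF le_measure ?inE //.
  - apply: measurable_preimage_closed; exact: compact_closed cKE.
  - exact: measurable_preimage_open.
  - by apply: preimage_subset; rewrite -bigcup_fset.
have mK : measurable (G @^-1` (~` K)).
  by apply: measurable_preimage_open; exact: closed_openC.
have mKE : measurable (G @^-1` (K `\` E)).
  by apply: measurable_preimage_closed; exact: compact_closed cKE.
(* Outside [E] a value is either outside [K], with probability at most [eps], or in the null set [K]
   minus [E]. *)
apply: (@le_trans _ _ (Q (G @^-1` (~` K) `|` G @^-1` (K `\` E)))).
  rewrite le_measure ?inE //.
  - by apply: measurable_preimage_closed; exact: open_closedC.
  - exact: measurableU.
  - by move=> w /= nE; have [Kw|nK] := pselect (K (G w)); [right|left].
by rewrite measureU0.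
Qed.

End borel_elements.

(** * Transfer of the bounded Lipschitz bound for fixed data *)

Section conditional_transfer.
Context {R : realType} {D E : normedModType R} {d dG : measure_display}
  {T : measurableType d} {TG : measurableType dG}.
Context (Q : probability T R) (PG : probability TG R) (Z : T -> D)
  (G : {RV PG >-> borelType D}).

Lemma bl_dist_ge0 (A : normedModType R) (Y : T -> A) (H : TG -> A) :
  (0 <= bl_dist Q Y PG H)%E.
Proof.
have B0 : @BL1 R A (fun=> 0).
  by split=> *; rewrite ?subrr normr0.
apply: (le_trans (abse_ge0 _)); apply: ereal_sup_ubound.
by exists (fun=> 0).
Qed.

(** The distance is applied to [L^-1 * g], and the factor is then moved out of both outer
    expectations. *)
Lemma bl_dist_lipschitz (g : D -> R) (L eta : R) :
  (bl_dist Q Z PG G <= eta%:E)%E -> 1 <= L -> (forall a, `|g a| <= 1) ->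
  (forall a a', `|g a - g a'| <= L * `|a - a'|) ->
  `|fine (outer_expectation Q (g \o Z)) - fine (outer_expectation PG (g \o G))|
    <= L * eta.
Proof.
move=> bl L1 g1 glip; have L0 : 0 < L by lra.
have Bg := BL1_scale _ _ L1 g1 glip; have [Bg1 Bg2] := Bg.
have cg : continuous (fun a => L^-1 * g a).
  by apply: (lipschitz_continuous _ 1) => // a a'; rewrite mul1r; exact: Bg2.
pose k a := L^-1 * g a.
have : (`|outer_expectation Q (k \o Z) - 'E_PG[k \o G]| <= eta%:E)%E.
  by apply: le_trans bl; apply: ereal_sup_ubound; exists k.
have mk : measurable_fun [set: TG] (k \o G) by exact: measurable_continuous_comp.
rewrite -(outer_expectation_measurable PG (k \o G) 1 (fun=> Bg1 _) mk).
rewrite -(fineK (outer_expectation_fin_num Q (k \o Z) 1 (fun=> Bg1 _))).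
rewrite -(fineK (outer_expectation_fin_num PG (k \o G) 1 (fun=> Bg1 _))).
rewrite -EFinB lee_fin.
have Li0 : 0 < L^-1 by rewrite invr_gt0.
rewrite (outer_expectation_fineZ Q (g \o Z) 1 _ (fun=> g1 _) Li0).
rewrite (outer_expectation_fineZ PG (g \o G) 1 _ (fun=> g1 _) Li0).
by rewrite -mulrBr normrM (ger0_norm (ltW Li0)) ler_pdivrMl.
Qed.

(** [L] and [dl] govern the approximation of [f \o dphi] near [K]; [L'] and [s'] govern the cutoff
    charged outside [enlargement K s]. As [psi \o Z] may be nonmeasurable, only Lipschitz functions
    are compared across the two laws; within each law pointwise bounds are used. *)
Lemma bl_dist_transfer (dphi psi : D -> E) (K : set D)
    (e eta dl L L' s s' : R) :
  continuous dphi -> K !=set0 -> 0 < e ->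
  (forall b a, K b -> `|a - b| < dl -> `|dphi a - dphi b| <= e) ->
  1 <= L -> 2 <= L * dl -> s <= dl -> L * s <= e ->
  1 <= L' -> 1 <= L' * s -> L' * s' <= e ->
  (PG (G @^-1` (~` enlargement K s')) <= e%:E)%E ->
  (forall a, enlargement K s a -> `|psi a - dphi a| <= e) ->
  (bl_dist Q Z PG G <= eta%:E)%E -> (L + 2 * L') * eta <= e ->
  (bl_dist Q (psi \o Z) PG (dphi \o G) <= (14 * e)%:E)%E.
Proof.
move=> cdphi K0 e0 dphiK L1 Ldl sdl Ls L'1 L's L's' PGK psiK bl etae.
have L0 : 0 <= L by lra. have L'0 : 0 <= L' by lra.
apply: ge_ereal_sup => _ [f [f1 flip] <-].
pose u := f \o dphi; pose v := f \o psi.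
pose k := lip_minorant K L u; pose h := lip_minorant K L' (fun=> 0).
have u1 a : `|u a| <= 1 by exact: f1.
have v1 a : `|v a| <= 1 by exact: f1.
have k1 a : `|k a| <= 1 by apply: lip_minorant_bound.
have h1 a : `|h a| <= 1.
  by apply: lip_minorant_bound => // b; rewrite normr0.
have klip a a' : `|k a - k a'| <= L * `|a - a'| by apply: lip_minorant_lip.
have hlip a a' : `|h a - h a'| <= L' * `|a - a'|.
  by apply: lip_minorant_lip => // b; rewrite normr0.
have h0 a : 0 <= h a by exact: lip_minorant0_ge0.
have cu : continuous u.
  move=> a; apply: continuous_comp; first exact: cdphi.
  by apply: (lipschitz_continuous _ 1) => // x y; rewrite mul1r; exact: flip.
have udl b a : K b -> `|a - b| < dl -> `|u a - u b| <= e.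
  by move=> Kb ab; apply: le_trans (flip _ _) (dphiK _ _ Kb ab).
have far a : ~ enlargement K s a -> 1 <= h a by exact: lip_minorant0_far.
(* Away from [K] the two functions differ by at most 2, which [2 * h a] absorbs. *)
have uk a : `|u a - k a| <= 2 * e + 2 * h a.
  have [Ka|/far ha] := pselect (enlargement K s a).
    have := lip_minorant_approx K K0 L e s dl u a L0 u1 udl Ldl sdl Ls Ka.
    by have := h0 a; rewrite -/k; lra.
  by have := ler_normB (u a) (k a); have := u1 a; have := k1 a; lra.
have vk a : `|v a - k a| <= 3 * e + 2 * h a.
  have [Ka|/far ha] := pselect (enlargement K s a).
    have := lip_minorant_approx K K0 L e s dl u a L0 u1 udl Ldl sdl Ls Ka.
    have := le_trans (flip _ _) (psiK a Ka).
    have := ler_normD (v a - u a) (u a - k a); rewrite addrA subrK.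
    by have := h0 a; rewrite -/k /u /v /=; lra.
  by have := ler_normB (v a) (k a); have := v1 a; have := k1 a; lra.
have kbl := bl_dist_lipschitz _ _ _ bl L1 k1 klip.
have hbl := bl_dist_lipschitz _ _ _ bl L'1 h1 hlip.
(* Outer expectation is not linear, so each absolute difference is handled by two one-sided
   bounds. *)
have vZ : fine (outer_expectation Q (v \o Z)) <= 3 * e +
    1 * fine (outer_expectation Q (k \o Z)) + 2 * fine (outer_expectation Q (h \o Z)).
  apply: (outer_expectation_fine_le Q _ _ _ 1) => // w; rewrite ?v1 ?k1 ?h1 //=.
  by have := vk (Z w); rewrite ler_norml => /andP[_ ?]; lra.
have kZ : fine (outer_expectation Q (k \o Z)) <= 3 * e +
    1 * fine (outer_expectation Q (v \o Z)) + 2 * fine (outer_expectation Q (h \o Z)).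
  apply: (outer_expectation_fine_le Q _ _ _ 1) => // w; rewrite ?v1 ?k1 ?h1 //=.
  by have := vk (Z w); rewrite ler_norml => /andP[? _]; lra.
have uG : fine (outer_expectation PG (u \o G)) <= 2 * e +
    1 * fine (outer_expectation PG (k \o G)) + 2 * fine (outer_expectation PG (h \o G)).
  apply: (outer_expectation_fine_le PG _ _ _ 1) => // w; rewrite ?u1 ?k1 ?h1 ?i1 //=.
  by have := uk (G w); rewrite ler_norml => /andP[_ ?]; lra.
have kG : fine (outer_expectation PG (k \o G)) <= 2 * e +
    1 * fine (outer_expectation PG (u \o G)) + 2 * fine (outer_expectation PG (h \o G)).
  apply: (outer_expectation_fine_le PG _ _ _ 1) => // w; rewrite ?u1 ?k1 ?h1 ?i1 //=.
  by have := uk (G w); rewrite ler_norml => /andP[? _]; lra.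
(* [h] is at most [e] on the smaller enlargement and at most 1 elsewhere, so its mean under [G] is
   at most [2 * e]. *)
pose B := G @^-1` (~` enlargement K s').
have mB : measurable B.
  by apply: measurable_preimage_closed; apply: open_closedC; exact: open_enlargement.
have i1 w : `|(\1_B w : R)| <= 1 by rewrite ger0_norm // indic_le1.
have EB : fine (outer_expectation PG (\1_B : TG -> R)) <= e.
  rewrite (outer_expectation_measurable PG _ 1 i1); last exact: measurable_indic.
  by rewrite expectation_indic // -lee_fin fineK // fin_num_measure.
have hG : fine (outer_expectation PG (h \o G)) <= e +
    1 * fine (outer_expectation PG (\1_B : TG -> R)) + 0 * fine (outer_expectation PG (h \o G)).
  apply: (outer_expectation_fine_le PG _ _ _ 1) => // w; rewrite ?u1 ?k1 ?h1 ?i1 //=.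
  rewrite indicE; have [Bw|nBw] := boolP (w \in B); rewrite ?mulr1n ?mulr0n.
    by have := h1 (G w); rewrite ler_norml => /andP[_ ?]; lra.
  have : h (G w) <= e.
    apply: (lip_minorant0_near K L' s') => //.
    by apply: contrapT => nK; move/negP: nBw; apply; rewrite inE.
  lra.
rewrite -(outer_expectation_measurable PG (u \o G) 1 (fun=> u1 _)); last first.
  exact: measurable_continuous_comp.
rewrite -(fineK (outer_expectation_fin_num Q (v \o Z) 1 (fun=> v1 _))).
rewrite -(fineK (outer_expectation_fin_num PG (u \o G) 1 (fun=> u1 _))).
rewrite -EFinB lee_fin.
(* The total is [3e + 2(2e + L' eta)] for [v] against [k] under [Z], [L eta] for [k] across the
   laws, and [2e + 4e] under [G]: [13e + (L + 2L') eta <= 14e]. *)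
move: etae kbl hbl; rewrite mulrDl -mulrA !ler_norml => etae /andP[? ?] /andP[? ?].
by apply/andP; split; lra.
Qed.

End conditional_transfer.
Theorem theorem3p2 (R : realType) (D E : completeNormedModType R)
  (D0 Dphi : set D) (theta0 : D) (theta0_Dphi : Dphi theta0)
  (phi : D -> E)
  (dphi : D -> E)
  (dphi_derivative : hadamard_dir_derivative Dphi phi theta0 D0 dphi)
  (dphi_continuous : continuous dphi)
  (* data {X_i} and weights {W_i}, i = 1, .., n *)
  (dO dX dW dG : measure_display)
  (Omega : measurableType dO) (P : probability Omega R)
  (TX : measurableType dX) (TW : measurableType dW)
  (X : forall n : nat, {RV P >-> n.-tuple TX})
  (W : forall n : nat, {RV P >-> n.-tuple TW})
  (OmegaG : measurableType dG) (PG : probability OmegaG R)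
  (G0 : {RV PG >-> borelType D})
  (thetahat : forall n : nat, n.-tuple TX -> D)
  (thetahat_Dphi : forall n x, Dphi (thetahat n x))
  (r : nat -> R) (r_nondecreasing : nondecreasing_seq r)
  (r_pinfty : r @ \oo --> +oo)
  (thetahat_weak_cvg : weak_cvg (fun n => distribution P (X n))
     (fun n x => r n *: (thetahat n x - theta0)) G0)
  (G0_tight : tight_element G0)
  (G0_support : law_support G0 `<=` D0)
  (thetastar : forall n : nat, n.-tuple TX -> n.-tuple TW -> D)
  (thetastar_Dphi : forall n x w, Dphi (thetastar n x w))
  (W_indep_X : forall n, independent_rvs (W n) (X n))
  (bootstrap_consistent : little_op (fun n => distribution P (X n))
     (fun n x => bl_dist (distribution P (W n))
        (fun w => r n *: (thetastar n x w - thetahat n x)) PG G0))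
  (bootstrap_asymp_measurable : asymptotically_measurable
     (fun n => distribution P (pair_fun (X n) (W n)))
     (fun n xw => r n *: (thetastar n xw.1 xw.2 - thetahat n xw.1)))
  (bootstrap_measurable : forall f : D -> R, bounded_continuous f ->
     forall n, {ae distribution P (X n), forall x,
       measurable_fun [set: n.-tuple TW]
         (fun w => f (r n *: (thetastar n x w - thetahat n x)))})
  (phihat : forall n : nat, n.-tuple TX -> D -> E)
  (phihat_consistent : forall K : set D, compact K -> K `<=` D0 ->
     forall eps : R, 0 < eps ->
     (fun delta : R => limn_esup (fun n => outer_prob (distribution P (X n))
        [set x | (eps%:E < ereal_sup
           [set (`| phihat n x h - dphi h |)%:E
           | h in enlargement K delta])%E])) @ 0^'+ --> 0%E) :
  little_op (fun n => distribution P (X n))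
    (fun n x => bl_dist (distribution P (W n))
       (fun w => phihat n x (r n *: (thetastar n x w - thetahat n x)))
       PG (dphi \o G0)).
Proof.
move=> eps eps0; apply: cvge0P => [n|gam gam0]; first exact: outer_prob_ge0.
(* [14 * e] is the error of [bl_dist_transfer]; [e < 1] makes [K] nonempty. *)
have [e [e0 e1 eeps]] : exists e : R, [/\ 0 < e, e < 1 & 14 * e < eps].
  exists (Num.min (eps / 28) (1 / 2)); split.
  - by rewrite lt_min; apply/andP; split; lra.
  - by rewrite gt_min; apply/orP; right; lra.
  - have : Num.min (eps / 28) (1 / 2) <= eps / 28 by rewrite ge_min lexx.
    lra.
have [K [cK KS PGK]] := tight_support G0 e G0_tight e0.
have K0 : K !=set0.
  (* An empty [K] has empty enlargements, whose complement has mass 1, more than [e]; any radius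
     shows this. *)
  apply/set0P/negP => /eqP K0; have := PGK 1 ltr01.
  rewrite (_ : _ @^-1` _ = [set: OmegaG]); last first.
    apply/seteqP; split=> // w _ /= /enlargementP[b].
    by rewrite K0.
  by rewrite probability_setT lee_fin => ?; lra.
have [dl dl0 dphiK] := compact_uniform_nbhs dphi K e cK dphi_continuous e0.
pose L := 1 + 2 / dl; have dli0 : 0 < 2 / dl by rewrite divr_gt0.
have L1 : 1 <= L by rewrite /L; lra.
have Ldl : 2 <= L * dl by rewrite /L mulrDl divfK ?gt_eqF // mul1r; lra.
have eL0 : 0 < e / L by rewrite divr_gt0 //; lra.
have g20 : 0 < gam / 2 by lra.
(* [s] comes after [L], to ensure [L * s <= e]; consistency of [phihat] also allows it to make the
   first exceptional probability small. *)
have [s [s0 sdl sL sup_lt]] : exists s : R, [/\ 0 < s, s <= dl, s <= e / L &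
    (limn_esup (fun n => outer_prob (distribution P (X n))
        [set x | (e%:E < ereal_sup
           [set (`| phihat n x h - dphi h |)%:E
           | h in enlargement K s])%E]) < (gam / 2)%:E)%E].
  have KD0 := subset_trans KS G0_support.
  near (0 : R)^'+ => s; exists s; split; near: s.
  - exact: nbhs_right_gt.
  - exact: nbhs_right_le.
  - exact: nbhs_right_le.
  - exact: (cvge0_lt _ _ (phihat_consistent K cK KD0 e e0) g20).
have Ls : L * s <= e by rewrite mulrC -ler_pdivlMr //; lra.
pose L' := 1 + 1 / s; have si0 : 0 < 1 / s by rewrite divr_gt0.
have L'1 : 1 <= L' by rewrite /L'; lra.
have L's : 1 <= L' * s by rewrite /L' mulrDl divfK ?gt_eqF // mul1r; lra.
have L'L0 : 0 < L + 2 * L' by lra.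
have L's' : L' * (e / L') <= e by rewrite mulrC divfK // gt_eqF //; lra.
(* Chosen last, since it must absorb both Lipschitz constants. *)
pose eta := e / (L + 2 * L').
have eta0 : 0 < eta by rewrite divr_gt0.
have etaE : (L + 2 * L') * eta <= e by rewrite mulrC divfK // gt_eqF.
have PGs' : (PG (G0 @^-1` (~` enlargement K (e / L'))) <= e%:E)%E.
  by apply: PGK; rewrite divr_gt0 //; lra.
near=> n.
have sup_n : (outer_prob (distribution P (X n)) [set x | (e%:E < ereal_sup
    [set (`| phihat n x h - dphi h |)%:E | h in enlargement K s])%E]
    < (gam / 2)%:E)%E.
  by near: n; exact: limn_esup_lt.
have boot_n : (outer_prob (distribution P (X n)) [set x | eta%:E <
    `|bl_dist (distribution P (W n))
        (fun w => r n *: (thetastar n x w - thetahat n x)) PG G0|]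
    < (gam / 2)%:E)%E.
  by near: n; exact: (cvge0_lt _ _ (bootstrap_consistent eta eta0) g20).
(* Half of [gam] goes to each exceptional event, a large bootstrap distance or a poor [phihat] near
   [K]. Off both events [bl_dist_transfer] applies to the fixed data [x]. *)
rewrite [X in (_ < X%:E)%E](splitr gam) EFinD.
apply: le_lt_trans (lteD boot_n sup_n); apply: outer_probU_le => x /= epsx.
apply: contrapT => /not_orP[/negP]; rewrite -leNgt gee0_abs ?bl_dist_ge0 // => bl.
move=> /negP; rewrite -leNgt => /ereal_supP psi.
move: epsx; rewrite gee0_abs ?bl_dist_ge0 //; apply/negP; rewrite -leNgt.
apply: (@le_trans _ _ (14 * e)%:E); last by rewrite lee_fin ltW.
apply: (bl_dist_transfer _ _ _ G0 dphi (phihat n x) K e eta dl L L' s (e / L')) => //.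
by move=> a Ka; rewrite -lee_fin; apply: psi; exists a.
Unshelve. all: by end_near. Qed.
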